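(* There are uncountably many pairs $(\mathcal{P},\mathcal{Q})$ of disjoint non-trivial graph properties such that $\chi_{\mathcal{P}}$ and $\chi_{\mathcal{Q}}$ are d.p.-incomparable.
   Context: All graphs are finite, simple, loop-free and have at least one vertex. A graph property is a class of graphs closed under isomorphism. It is trivial if it is empty, contains only finitely many graphs up to isomorphism, or contains all graphs; otherwise it is non-trivial. For a graph $G$ of order $n$, $h_i^{\mathcal{P}}(G)$ is the number of partitions of $V(G)$ into exactly $i$ nonempty blocks such that each block $B$ induces a graph $G[B]\in\mathcal{P}$. The Harary polynomial is $\chi_{\mathcal{P}}(G;k)=\sum_{i=1}^{n} h_i^{\mathcal{P}}(G)\,k_{(i)}$, where $k_{(i)}=k(k-1)\cdots(k-i+1)$. Two graph parameters $F_1,F_2$ are d.p.-incomparable if there are graphs $H_1,H_1',H_2,H_2'$ with $F_1(H_1)=F_1(H_1')$, $F_2(H_1)\neq F_2(H_1')$, $F_1(H_2)\neq F_1(H_2')$ and $F_2(H_2)=F_2(H_2')$. *)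

(* Defs.v *)
From mathcomp Require Import all_boot all_order all_algebra.
From mathcomp Require Import boolp.

Set Implicit Arguments.
Unset Strict Implicit.
Unset Printing Implicit Defensive.

Import GRing.Theory.
Local Open Scope ring_scope.

Record graph := Graph {
  vertex :> finType;
  adj : rel vertex;
  adj_sym : symmetric adj;
  adj_irr : irreflexive adj;
  vertex_gt0 : (0 < #|vertex|)%N }.

Definition graph_iso (G H : graph) : Prop :=
  exists2 f : G -> H, bijective f & forall x y, adj (f x) (f y) = adj x y.

Section Induced.
Variables (G : graph) (B : {set G}).

Definition induced_adj : rel {x : G | x \in B} :=
  [rel x y | adj (val x) (val y)].

Lemma induced_adj_sym : symmetric induced_adj.
Proof. by move=> x y; exact: adj_sym. Qed.

Lemma induced_adj_irr : irreflexive induced_adj.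
Proof. by move=> x; exact: adj_irr. Qed.

Lemma induced_gt0 : B != set0 -> (0 < #|{: {x : G | x \in B}}|)%N.
Proof. by rewrite card_sig card_gt0. Qed.

Definition induced (B0 : B != set0) : graph :=
  Graph induced_adj_sym induced_adj_irr (induced_gt0 B0).

End Induced.

(* Neither [set graph] nor [countable] of mathcomp.classical can be used on
   classes of graphs: [graph] quantifies over [finType], and the universe of
   [set] lies strictly below that of [Finite.type]. *)
Definition graph_class := graph -> Prop.

Definition graph_property (P : graph_class) : Prop :=
  forall G H : graph, graph_iso G H -> P G -> P H.

Definition finite_up_to_iso (P : graph_class) : Prop :=
  exists (m : nat) (H : 'I_m -> graph),
    forall G, P G -> exists i, graph_iso G (H i).

Definition trivial_property (P : graph_class) : Prop :=
  [\/ forall G, ~ P G, finite_up_to_iso P | forall G, P G].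

Definition disjoint_classes (P Q : graph_class) : Prop :=
  forall G, ~ (P G /\ Q G).

(* [B0] always exists for a block [B] of a partition; it is only there because
   a graph must have at least one vertex. *)
Definition harary_partitions (P : graph_class) (G : graph) (i : nat) :
    {set {set {set G}}} :=
  [set S : {set {set G}} | [&& partition S [set: G], #|S| == i &
     `[< forall B, B \in S -> exists B0 : B != set0, P (induced B0) >]]].

Definition harary_coef (P : graph_class) (G : graph) (i : nat) : nat :=
  #|harary_partitions P G i|.

Definition falling_poly (i : nat) : {poly int} :=
  \prod_(0 <= j < i) ('X - j%:R%:P).

Definition harary_poly (P : graph_class) (G : graph) : {poly int} :=
  \sum_(1 <= i < #|G|.+1) falling_poly i *+ harary_coef P G i.

Definition dp_incomparable (T1 T2 : Type) (F1 : graph -> T1) (F2 : graph -> T2)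
    : Prop :=
  exists H1 H1' H2 H2' : graph,
    [/\ F1 H1 = F1 H1', F2 H1 <> F2 H1', F1 H2 <> F1 H2' & F2 H2 = F2 H2'].

Definition countably_many (T : Type) (A : T -> Prop) : Prop :=
  exists f : T -> nat, forall x y, A x -> A y -> f x = f y -> x = y.

(* Main.v *)
Require Import Defs.
From mathcomp Require Import all_boot all_order all_algebra.
From mathcomp Require Import boolp.

(** To a binary sequence [a] attach the two sets of orders
    [{p ^ (2n + a n + 1) | n}] for [p = 2, 3], and let [P], [Q] be the classes
    of graphs whose order lies in the first, resp. second, set.  Distinct
    sequences give distinct pairs, and there are uncountably many sequences.
    A graph whose order is not divisible by [2] has no partition into blocks
    of even order, so its [P]-Harary polynomial vanishes, while the Harary
    polynomial of a member of a class does not vanish at [1].  Comparing a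
    member of either class with the one-vertex graph thus gives
    incomparability. *)

Set Implicit Arguments.
Unset Strict Implicit.
Unset Printing Implicit Defensive.

Import GRing.Theory.

Lemma graph_iso_card (G H : graph) : graph_iso G H -> #|G| = #|H|.
Proof. by case=> f bij_f _; exact: bij_eq_card bij_f. Qed.

Lemma edgeless_sym n : symmetric (fun _ _ : 'I_n.+1 => false).
Proof. by []. Qed.

Lemma edgeless_irr n : irreflexive (fun _ _ : 'I_n.+1 => false).
Proof. by []. Qed.

Lemma edgeless_gt0 n : 0 < #|'I_n.+1|.
Proof. by rewrite card_ord. Qed.

(** The shift to [n.+1] vertices makes every index legal; [edgeless 0] is the one-vertex graph. *)
Definition edgeless n : graph :=
  Graph (@edgeless_sym n) (@edgeless_irr n) (edgeless_gt0 n).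

Lemma card_edgeless n : #|edgeless n| = n.+1.
Proof. exact: card_ord. Qed.

Section HararyPoly.
Local Open Scope ring_scope.

Lemma falling_poly1 i : (falling_poly i.+2).[1] = 0.
Proof.
(* Peel off the factors for [j = 0] and [j = 1]; the latter vanishes at 1. *)
rewrite /falling_poly horner_prod big_ltn // big_ltn //.
by rewrite !hornerE subrr /= mulr0 mul0r.
Qed.

Lemma horner_harary_poly1 (P : graph_class) (G : graph) :
  (harary_poly P G).[1] = (harary_coef P G 1)%:R.
Proof.
rewrite /harary_poly horner_sum big_ltn ?ltnS ?vertex_gt0 //.
rewrite big_nat big1 ?addr0 => [|[|[|i]] //].
  by rewrite hornerMn /falling_poly big_nat1 !hornerE.
by rewrite hornerMn falling_poly1 mul0rn.
Qed.

(** The one-block partition counts: its block induces a copy of [G], which lies in [P] by closure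
    under isomorphism. *)
Lemma harary_coef1_gt0 (P : graph_class) (G : graph) :
  graph_property P -> P G -> (0 < harary_coef P G 1)%N.
Proof.
move=> isoP PG; have T0 : [set: G] != set0 by rewrite -card_gt0 cardsT vertex_gt0.
apply/card_gt0P; exists [set [set: G]].
rewrite inE cards1 eqxx andTb; apply/andP; split.
  by rewrite /partition /cover big_set1 eqxx trivIset1 inE eq_sym.
apply/asboolP => B /set1P ->; exists T0; apply: isoP PG.
exists (fun x : G => exist _ x (in_setT x)) => //.
by exists val => [//|x]; apply: val_inj.
Qed.

Lemma harary_poly_neq0 (P : graph_class) (G : graph) :
  graph_property P -> P G -> harary_poly P G <> 0.
Proof.
move=> isoP PG /(congr1 (fun p => p.[1])); rewrite horner_harary_poly1 horner0.
by move/eqP; rewrite Num.Theory.pnatr_eq0 eqn0Ngt harary_coef1_gt0.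
Qed.

(** The block orders add up to the order of [G], so a single admissible partition would make [d]
    divide it; hence every coefficient is zero. *)
Lemma harary_poly_dvd0 (d : nat) (P : graph_class) (G : graph) :
  (forall H, P H -> (d %| #|H|)%N) -> ~~ (d %| #|G|)%N -> harary_poly P G = 0.
Proof.
move=> dvdP /negP ndvdG; apply: big1 => i _.
rewrite /harary_coef; case: (set_0Vmem (harary_partitions P G i)) => [->|[S]].
  by rewrite cards0.
rewrite inE => /and3P[partS _ /asboolP blockP]; case: ndvdG.
rewrite -cardsT (card_partition partS); apply: dvdn_sum => B /blockP[B0 /dvdP].
by rewrite card_sig.
Qed.

Lemma dvd_dp_incomparable (d e : nat) (P Q : graph_class) (G H : graph) :
    graph_property P -> graph_property Q ->
    (forall K, P K -> (d %| #|K|)%N) -> (forall K, Q K -> (e %| #|K|)%N) ->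
    (1 < d)%N -> (1 < e)%N -> P G -> Q H ->
    ~~ (e %| #|G|)%N -> ~~ (d %| #|H|)%N ->
  dp_incomparable (harary_poly P) (harary_poly Q).
Proof.
move=> isoP isoQ dP eQ d_gt1 e_gt1 PG QH eG dH.
have n1 k : (1 < k)%N -> ~~ (k %| #|edgeless 0|)%N.
  by rewrite card_edgeless dvdn1 neq_ltn orbC => ->.
have P0 := harary_poly_dvd0 dP (n1 d d_gt1).
have Q0 := harary_poly_dvd0 eQ (n1 e e_gt1).
exists H, (edgeless 0), G, (edgeless 0); rewrite P0 Q0.
split; [exact: harary_poly_dvd0 dH | exact: harary_poly_neq0 |
        exact: harary_poly_neq0 | exact: harary_poly_dvd0 eG].
Qed.

End HararyPoly.

(** Half of [n.*2 + a n] is [n] and its parity is the bit [a n]; the successor keeps the exponent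
    positive, so [p] divides the order. *)
Definition code_order p (a : nat -> bool) n := p ^ (n.*2 + a n).+1.

Definition code_class p (a : nat -> bool) : graph_class :=
  fun G => exists n, #|G| = code_order p a n.

Section CodeClass.
Variables (p : nat) (p_pr : prime p).
Implicit Type a : nat -> bool.

Let p_gt1 : 1 < p := prime_gt1 p_pr.

Lemma code_class_property a : graph_property (code_class p a).
Proof. by move=> G H /graph_iso_card GH [n Gn]; exists n; rewrite -GH. Qed.

Lemma code_class_dvd a G : code_class p a G -> p %| #|G|.
Proof. by case=> n ->; rewrite dvdn_exp. Qed.

Lemma ltn_code_order a n : n < code_order p a n.
Proof.
apply: leq_trans (ltn_expl _ p_gt1).
by rewrite ltnS leqW // -addnn -addnA leq_addr.
Qed.

Lemma card_edgeless_code a n :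
  #|edgeless (code_order p a n).-1| = code_order p a n.
Proof.
by rewrite card_edgeless prednK; last exact: leq_ltn_trans (ltn_code_order a n).
Qed.

Lemma code_class_edgeless a n :
  code_class p a (edgeless (code_order p a n).-1).
Proof. by exists n; exact: card_edgeless_code. Qed.

Lemma code_class_nontrivial a : ~ trivial_property (code_class p a).
Proof.
case=> [none|[m [H finH]]|all].
- exact: none _ (code_class_edgeless a 0).
(* The member of index [N] has order above [N], too large for any [H i]. *)
- pose N := \max_(i < m) #|H i|.
  have [i /graph_iso_card] := finH _ (code_class_edgeless a N).
  rewrite card_edgeless_code => cardHi.
  have : #|H i| <= N by apply: (leq_bigmax i).
  by rewrite -cardHi leqNgt ltn_code_order.
- by have := code_class_dvd (all (edgeless 0)); rewrite card_edgeless dvdn1 gtn_eqF.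
Qed.

Lemma code_class_inj : injective (code_class p).
Proof.
move=> a b eq_ab; apply: funext => n.
have := code_class_edgeless a n; rewrite eq_ab => -[m].
rewrite card_edgeless_code => /eqP.
rewrite eqn_exp2l // eqSS ![_.*2 + _]addnC => /eqP eq_nm.
(* Halving gives [n = m]; parity then gives [a n = b m]. *)
have := congr1 half eq_nm; rewrite !half_bit_double => {2}->.
by have := congr1 odd eq_nm; rewrite !oddD !odd_double !addbF !oddb.
Qed.

End CodeClass.

Lemma code_dvdn p q a n : prime p -> prime q -> p != q -> ~~ (p %| code_order q a n).
Proof. by move=> p_pr q_pr; rewrite Euclid_dvdX // dvdn_prime2 // andbT. Qed.

Lemma code_class_dp_incomparable p q a : prime p -> prime q -> p != q ->
  dp_incomparable (harary_poly (code_class p a)) (harary_poly (code_class q a)).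
Proof.
move=> p_pr q_pr neq_pq.
have Pp := code_class_edgeless p_pr a 0; have Qq := code_class_edgeless q_pr a 0.
have [[n cardp] [m cardq]] := (Pp, Qq).
apply: (@dvd_dp_incomparable p q _ _ _ _ _ _ _ _ _ _ Pp Qq).
- exact: code_class_property.
- exact: code_class_property.
- exact: code_class_dvd.
- exact: code_class_dvd.
- exact: prime_gt1.
- exact: prime_gt1.
- by rewrite cardp code_dvdn // eq_sym.
- by rewrite cardq code_dvdn.
Qed.

(** Cantor's diagonal: by injectivity the only [a] with [g a = g D] is [D], so [D (g D)] would hold
    exactly when it fails. *)
Lemma no_inj_cantor_nat (g : (nat -> bool) -> nat) : ~ injective g.
Proof.
move=> inj_g; pose D n := `[< exists2 a, g a = n & ~~ a n >].
case: (boolP (D (g D))) => DgD.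
- by move/asboolP: (DgD) => [a /inj_g -> /negP].
- by move/asboolP: (DgD); apply; exists D.
Qed.

Theorem theorem7p4 :
  ~ countably_many (fun PQ : graph_class * graph_class =>
      [/\ graph_property PQ.1 /\ ~ trivial_property PQ.1,
          graph_property PQ.2 /\ ~ trivial_property PQ.2,
          disjoint_classes PQ.1 PQ.2 &
          dp_incomparable (harary_poly PQ.1) (harary_poly PQ.2)]).
Proof.
case=> f inj_f; pose pair a := (code_class 2 a, code_class 3 a).
apply: (@no_inj_cantor_nat (f \o pair)) => a b eq_f.
suff [/code_class_inj->] : pair a = pair b by [].
apply: inj_f eq_f; [move: a | move: b] => c; split=> /=.
all: try by split; [exact: code_class_property | exact: code_class_nontrivial].
all: try exact: code_class_dp_incomparable.
(* Disjointness: the order of a common member would be a power of 2 divisible by 3. *)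
all: by move=> G [[n cardG] /code_class_dvd]; rewrite cardG; apply/negP/code_dvdn.
Qed.
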